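(* Let $G=(V,E)$ be any finite simple undirected graph with $V\neq\emptyset$. Then: (i) for every coalition game $\mathcal G$ over $G$, $\dfrac{\kappa(\mathcal G)}{\kappa^f(\mathcal G)}\le \tau(G)$; (ii) there exists a coalition game $\mathcal G$ over $G$ with $\dfrac{\kappa(\mathcal G)}{\kappa^f(\mathcal G)}\ge \tfrac14\tau(G)$.
   Context: Coalition game over an interaction graph: for a finite simple undirected graph $G=(V,E)$, a coalition game $\mathcal G$ over $G$ is given by a valuation $v:2^V\to\mathbb Z_{\ge 0}$ such that $v(\emptyset)=0$, $v(S)=0$ whenever the induced subgraph $G[S]$ is disconnected, and $v$ is not identically zero. Define $\kappa^f(\mathcal G)=\min\{\sum_{i\in V}x_i : x\in\mathbb R_{\ge0}^V,\ \sum_{i\in S}x_i\ge v(S)\ \forall S\subseteq V\}$ and $\kappa(\mathcal G)$ the same minimum over $x\in\mathbb Z_{\ge 0}^V$. Thicket: a finite collection $\mathcal H$ of nonempty subsets of $V$ such that each member induces a connected subgraph of $G$ and any two members intersect. A hitting set of $\mathcal H$ is a vertex set meeting every member; the hitting size $\tau(\mathcal H)$ is the minimum cardinality of a hitting set. The thicket number $\tau(G)$ is the maximum of $\tau(\mathcal H)$ over all thickets $\mathcal H$ of $G$. *)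

(* Defs.v *)
From HB Require Import structures.
From mathcomp Require Import all_boot all_order all_algebra.
Set Implicit Arguments. Unset Strict Implicit. Unset Printing Implicit Defensive.
Import Order.TTheory GRing.Theory Num.Theory.
Local Open Scope ring_scope.

(* A finite simple undirected graph is a symmetric irreflexive relation
   e : rel T on a finType T (vertex set V = T). *)

Definition induced_rel (T : finType) (e : rel T) (S : {set T}) : rel T :=
  fun x y => [&& x \in S, y \in S & e x y].

Definition induced_connected (T : finType) (e : rel T) (S : {set T}) : bool :=
  [forall x in S, forall y in S, connect (induced_rel e S) x y].

Definition coalition_game (T : finType) (e : rel T) (v : {set T} -> nat) : Prop :=
  [/\ v set0 = 0%N,
      (forall S : {set T}, ~~ induced_connected e S -> v S = 0%N)
    & exists S : {set T}, v S <> 0%N].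

Definition frac_feasible (R : realFieldType) (T : finType)
    (v : {set T} -> nat) (x : T -> R) : Prop :=
  (forall i, 0 <= x i) /\ (forall S : {set T}, (v S)%:R <= \sum_(i in S) x i).

Definition int_feasible (T : finType) (v : {set T} -> nat) (x : T -> nat) : Prop :=
  forall S : {set T}, (v S <= \sum_(i in S) x i)%N.

Definition is_kappaf (R : realFieldType) (T : finType) (v : {set T} -> nat) (k : R) : Prop :=
  (exists x : T -> R, frac_feasible v x /\ \sum_i x i = k) /\
  (forall x : T -> R, frac_feasible v x -> k <= \sum_i x i).

Definition is_kappa (T : finType) (v : {set T} -> nat) (k : nat) : Prop :=
  (exists x : T -> nat, int_feasible v x /\ (\sum_i x i)%N = k) /\
  (forall x : T -> nat, int_feasible v x -> (k <= \sum_i x i)%N).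

Definition thicket (T : finType) (e : rel T) (H : {set {set T}}) : bool :=
  [forall A in H, (A != set0) && induced_connected e A] &&
  [forall A in H, forall B in H, A :&: B != set0].

Definition hits (T : finType) (X : {set T}) (H : {set {set T}}) : bool :=
  [forall A in H, X :&: A != set0].

(* Hitting size: minimum cardinality of a hitting set (setT always hits a
   thicket, whose members are nonempty; the default #|T| is thus harmless). *)
Definition hitting_size (T : finType) (H : {set {set T}}) : nat :=
  \big[minn/#|T|]_(X : {set T} | hits X H) #|X|.

Definition thicket_number (T : finType) (e : rel T) : nat :=
  \max_(H : {set {set T}} | thicket e H) hitting_size H.

(* Main.v *)
Require Import Defs.
From HB Require Import structures.
From mathcomp Require Import all_boot all_order all_algebra.
From mathcomp Require Import zify ring lra.
From Stdlib Require Import Classical.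
Import Order.TTheory GRing.Theory Num.Theory.
Local Open Scope ring_scope.

Set Implicit Arguments. Unset Strict Implicit. Unset Printing Implicit Defensive.

(* Upper bound: in every family [F] of nonempty connected sets, some member [S] and some set
   [Y] of at most [thicket_number e] vertices are such that [Y] meets every member of [F] that
   meets [S].  A local-ratio argument then yields an integral cover and a packing of disjoint
   coalitions whose values differ by a factor at most [thicket_number e], and a packing bounds
   kappa^f from below.  [S] and [Y] come from a lowest bag of a vine decomposition (a tree
   decomposition in which an edge of the graph may also join two adjacent bags) whose bags have
   at most [thicket_number e] vertices; that it exists is the duality between thickets and vines.

   Lower bound: let [X] be a minimum hitting set of a thicket of maximum order [t]. The coalitions
   of value 1 are the connected sets containing more than half of [X]. The weight [2 / t] on [X]
   is feasible, while a set of fewer than [t / 2] vertices misses a coalition. *)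

(** * Connected sets and components *)

Definition edges_into (T : finType) (e : rel T) (D E : {set T}) : Prop :=
  forall x y, e x y -> x \in D -> y \in E.

(** Follow a path of [S] starting at [x]: no step leaves [D]. The target [~: S :|: D] means that
    only edges inside [S] have to be checked. *)
Lemma induced_connected_sub (T : finType) (e : rel T) (S D : {set T}) (x : T) :
  induced_connected e S -> x \in S -> x \in D -> edges_into e (S :&: D) (~: S :|: D) ->
  S \subset D.
Proof.
move=> /'forall_implyP cS xS xD closD; apply/subsetP=> y yS.
have /'forall_implyP /(_ y yS)/connectP[p pth ->] := cS x xS.
elim: p x {xS} xD pth => //= z p IHp x xD /andP[/and3P[xS zS exz]]; apply: IHp.
by have := closD x z exz; rewrite !inE xS xD zS; apply.
Qed.

(** If [a] lies in [X], no step from [a] is possible and this is the singleton of [a]; so it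
    contains [a] and is connected for every [a]. *)
Definition component (T : finType) (e : rel T) (X : {set T}) (a : T) : {set T} :=
  [set y | connect (induced_rel e (~: X)) a y].

Section Components.
Variables (T : finType) (e : rel T).
Hypothesis e_sym : symmetric e.
Implicit Types (X S : {set T}).

Lemma induced_rel_sym S : symmetric (induced_rel e S).
Proof. by move=> x y; rewrite /induced_rel e_sym andbCA. Qed.

Lemma mem_component X a : a \in component e X a.
Proof. by rewrite inE connect0. Qed.

Lemma component_disjoint X a : a \notin X -> [disjoint component e X a & X].
Proof.
move=> aX; rewrite disjoint_subset; apply/subsetP=> y; rewrite !inE => /connectP[p pth ->].
elim: p a aX pth => //= z p IHp a aX /andP[/and3P[_ zX _]]; apply: IHp.
by rewrite inE in zX.
Qed.

Lemma component_edges X a : a \notin X ->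
  edges_into e (component e X a) (component e X a :|: X).
Proof.
move=> aX x y exy xC; rewrite !inE orbC; case: (boolP (y \in X)) => //= yX.
have xX := disjointFr (component_disjoint aX) xC.
rewrite inE in xC; apply: connect_trans xC (connect1 _).
by rewrite /induced_rel !inE xX yX.
Qed.

Lemma component_eq X a b : b \in component e X a -> component e X b = component e X a.
Proof.
rewrite inE => ab; apply/setP=> y; rewrite !inE; apply/idP/idP; first exact: connect_trans.
apply: connect_trans; rewrite sym_connect_sym //; exact: induced_rel_sym.
Qed.

Lemma component_connected X a : induced_connected e (component e X a).
Proof.
have h b : a \notin X -> connect (induced_rel e (~: X)) a b ->
    connect (induced_rel e (component e X a)) a b.
  move=> aX /connectP[p pth ->].
  elim/last_ind: p pth => [|p z IHp]; first by rewrite connect0.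
  rewrite rcons_path last_rcons => /andP[pth lz].
  apply: connect_trans (IHp pth) (connect1 _).
  have lC : last a p \in component e X a by rewrite inE; apply/connectP; exists p.
  case/and3P: (lz) => _ _ elz; apply/and3P; split => //.
  by move: lC; rewrite !inE => /connect_trans; apply; apply: connect1.
apply/'forall_implyP => x xC; apply/'forall_implyP => y yC.
case: (boolP (a \in X)) => [aX|aX].
  have only u : u \in component e X a -> u = a.
    rewrite inE => /connectP[[|z p] //= /andP[/and3P[]]]; by rewrite inE aX.
  by rewrite (only x xC) (only y yC) connect0.
rewrite !inE in xC yC; apply: connect_trans (h _ aX yC).
rewrite sym_connect_sym; [exact: h | exact: induced_rel_sym].
Qed.

Lemma induced_connected_component S X a : induced_connected e S -> a \in S ->
  [disjoint S & X] -> S \subset component e X a.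
Proof.
move=> cS aS dSX; apply: (induced_connected_sub cS aS); first exact: mem_component.
move=> x y exy; rewrite !inE => /andP[xS ax]; case: (boolP (y \in S)) => //= yS.
apply: connect_trans ax (connect1 _).
by rewrite /induced_rel !inE (disjointFr dSX xS) (disjointFr dSX yS).
Qed.

End Components.

(** * Vine decompositions as trees of bags *)

(* A branch is a rooted piece of a vine decomposition, with root bag [B] and union of bags [U];
   [link e P B U] allows to hang it below the bag [P]: edges of the graph leave [U] only through
   [B], and edges from [U] outside [P] can only go to [U] or to [P]. *)
Definition link (T : finType) (e : rel T) (P B U : {set T}) : Prop :=
  [/\ U :&: P \subset B, edges_into e (U :\: B) U & edges_into e (U :\: P) (U :|: P)].

Inductive branch (T : finType) (e : rel T) (L : pred {set T}) (B U : {set T}) : Prop :=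
  Branch (cs : {set {set T} * {set T}}) of
    L B
  & (forall c, c \in cs -> link e B c.1 c.2)
  & (forall c, c \in cs -> branch e L c.1 c.2)
  & (forall c d, c \in cs -> d \in cs -> c != d -> c.2 :&: d.2 \subset B)
  & U = B :|: \bigcup_(c in cs) c.2.

Section Branches.
Variables (T : finType) (e : rel T).
Hypothesis e_sym : symmetric e.
Implicit Types (L : pred {set T}) (B U P Q X C W S : {set T}) (H F : {set {set T}}).

(** Descend to a lowest bag [B] whose branch contains a member [S] of [F]. A member that meets [S]
    but avoids [B] can leave neither [U] nor the child branch that it meets, so it would lie inside
    that child branch, against the choice of [B]. *)
Lemma branch_separates L B U F : branch e L B U -> edges_into e (U :\: B) U ->
  (forall S, S \in F -> S != set0 /\ induced_connected e S) ->
  (exists2 S, S \in F & S \subset U) ->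
  exists S Y, [/\ S \in F, L Y & forall S', S' \in F -> S' :&: S != set0 -> Y :&: S' != set0].
Proof.
elim=> {}B {}U cs LB lk _ IH _ defU clU Fc [S SF SU].
case: (classic (exists2 c, c \in cs & exists2 S', S' \in F & S' \subset c.2)) => [[c cc hc]|none].
  by apply: (IH c cc) => //; case: (lk c cc).
exists S, B; split=> // S' S'F S'S; have [S'0 cS'] := Fc S' S'F.
apply/negP=> /eqP BS'; have nB z : z \in S' -> z \notin B.
  by move=> zS'; apply/negP=> zB; have := in_set0 z; rewrite -BS' inE zB zS'.
have [z] := set0Pn _ S'S; rewrite inE => /andP[zS' zS].
have S'U : S' \subset U.
  apply: (induced_connected_sub cS' zS' (subsetP SU z zS)) => x y exy.
  rewrite !inE => /andP[xS' xU]; rewrite orbC; apply/orP; left; apply: clU exy _.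
  by rewrite inE nB.
have := subsetP S'U z zS'; rewrite defU inE (negbTE (nB z zS')) => /bigcupP[c cc zc].
apply: none; exists c => //; exists S' => //.
have [_ _ clc] := lk c cc.
apply: (induced_connected_sub cS' zS' zc) => x y exy.
rewrite !inE => /andP[xS' xc]; case: (boolP (y \in S')) => //= yS'.
by have := clc x y exy; rewrite !inE nB // xc (negbTE (nB y yS')) orbF; apply.
Qed.

Lemma branch_bag L B U : branch e L B U -> B \subset U.
Proof. by case=> cs _ _ _ _ ->; apply: subsetUl. Qed.

(* Walking down to a child [c] of [B], everything outside [c] hangs off [B]: it is one more
   branch at [c], which is how the tree gets re-rooted. *)
Lemma branch_reroot L L' B U (Q : {set {set T} * {set T}}) : branch e L' B U ->
  (forall q, q \in Q -> link e B q.1 q.2) ->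
  (forall q, q \in Q -> branch e L' q.1 q.2) ->
  (forall c d, c \in Q -> d \in Q -> c != d -> c.2 :&: d.2 \subset B) ->
  (forall q, q \in Q -> q.2 :&: U \subset B) ->
  U :|: \bigcup_(q in Q) q.2 = setT ->
  branch e L B U \/ exists W, [/\ L' W, ~~ L W & branch e L' W setT].
Proof.
move=> br; elim: br Q => {}B {}U cs LB lk br IH dis defU Q Qlk Qbr Qdis QU Qcov.
(* [Q] is the rest of the tree seen from [B]. If [B] violates [L], it is the new root, with its
   children and [Q] below it. *)
case: (boolP (L B)) => [gB|bB]; last first.
  right; exists B; split=> //; exists (cs :|: Q) => //.
  - by move=> c /setUP[/lk|/Qlk].
  - by move=> c /setUP[/br|/Qbr].
  - have cross c d : c \in cs -> d \in Q -> d.2 :&: c.2 \subset B.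
      move=> cc dQ; apply: subset_trans (QU d dQ); apply: setIS.
      by rewrite defU; apply: subset_trans (bigcup_sup _ cc) (subsetUr _ _).
    move=> c d /setUP[] cc /setUP[] dd cd; [exact: dis | rewrite setIC| | exact: Qdis];
      exact: cross.
  - by rewrite -Qcov defU bigcup_setU setUA.
apply: NNPP => none; apply: (none); left; exists cs => // c cc.
have [Uc clBc clc] := lk c cc.
(* [O] is what remains when the branch at [c] is cut off, seen as one branch rooted at [B]. With
   this as the new [Q], the induction hypothesis for [c] gives either an [L]-branch at [c] or the
   new root. *)
pose R := (cs :\ c) :|: Q; pose O := B :|: \bigcup_(r in R) r.2.
have cU : c.2 \subset U.
  by rewrite defU; apply: subset_trans (bigcup_sup _ cc) (subsetUr _ _).
have RB r : r \in R -> [/\ link e B r.1 r.2, branch e L' r.1 r.2 & r.2 :&: c.2 \subset B].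
  case/setUP=> [/setD1P[rc rcs]|rQ]; first by split; [exact: lk|exact: br|exact: dis].
  by split; [exact: Qlk | exact: Qbr | apply: subset_trans (QU r rQ); apply: setIS].
have Rdis r d : r \in R -> d \in R -> r != d -> r.2 :&: d.2 \subset B.
  have cross a b : a \in cs -> b \in Q -> b.2 :&: a.2 \subset B.
    move=> aa bQ; apply: subset_trans (QU b bQ); apply: setIS.
    by rewrite defU; apply: subset_trans (bigcup_sup _ aa) (subsetUr _ _).
  move=> /setUP[/setD1P[_ r1]|r1] /setUP[/setD1P[_ d1]|d1];
    [exact: dis | rewrite setIC => _ | move=> _ | exact: Qdis]; exact: cross.
have brO : branch e L' B O by exists R => // r /RB[].
have Oc : O :&: c.2 \subset B.
  apply/subsetP=> z; rewrite !inE => /andP[/orP[//|/bigcupP[r rR zr]] zc].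
  by have [_ _ /subsetP] := RB r rR; apply; rewrite inE zr.
have cB z : z \in O -> z \in c.2 -> (z \in B) && (z \in c.1).
  move=> zO zc; have zB : z \in B by apply: (subsetP Oc); rewrite inE zO.
  by rewrite zB (subsetP Uc) // inE zc.
have cov z : (z \in O) || (z \in c.2).
  have : z \in [set: T] by []; rewrite -Qcov defU !inE.
  case/orP=> [/orP[->//|/bigcupP[d dd zd]]|/bigcupP[q qQ zq]].
    case: (eqVneq d c) => [<-|dc]; first by rewrite zd orbT.
    by apply/orP; left; rewrite orbC; apply/orP; left; apply/bigcupP; exists d => //; rewrite !inE dc dd.
  by apply/orP; left; rewrite orbC; apply/orP; left; apply/bigcupP; exists q => //; rewrite !inE qQ orbT.
have BO : B \subset O by apply: subsetUl.
clearbody O; have [//|||||//|] := IH c cc [set (B, O)].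
- move=> _ /set1P ->; split=> /=.
  + apply/subsetP=> z; rewrite inE => /andP[zO zc].
    by have /andP[] := cB z zO (subsetP (branch_bag (br c cc)) z zc).
  + move=> x y exy; rewrite inE => /andP[xB xO]; apply: contraT => yO.
    have yc : y \in c.2 by have := cov y; rewrite (negbTE yO).
    have yB : y \notin B by apply: contra yO => /(subsetP BO).
    have := clc y x; rewrite e_sym !inE yB yc (negbTE xB) orbF => /(_ exy isT) xc.
    by have := cB x xO xc; rewrite (negbTE xB).
  + move=> x y exy; rewrite !inE => /andP[xc1 xO]; apply: contraT; rewrite negb_or => /andP[yO yc1].
    have yc : y \in c.2 by have := cov y; rewrite (negbTE yO).
    have := clBc y x; rewrite e_sym inE yc yc1 => /(_ exy isT) xc.
    by have := cB x xO xc; rewrite (negbTE xc1) andbF.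
- by move=> _ /set1P ->.
- by move=> a b /set1P -> /set1P ->; rewrite eqxx.
- move=> _ /set1P -> /=; apply/subsetP=> z; rewrite inE => /andP[zO zc].
  by have /andP[] := cB z zO zc.
- apply/setP=> z; by rewrite big_set1 !inE orbC cov.
by move=> ?; case: none; right.
Qed.

(* Restricts a decomposition rooted at [W] to the component [C] and turns its root into [X].
   The bags do not grow: the vertices of [X] outside [U] together with those of [B] outside [C]
   hit [H], so they are at least as many as [X]. *)
Lemma branch_transform k L L' H X C W :
  (#|X| <= k)%N -> edges_into e C (C :|: X) -> [disjoint C & X] -> [disjoint W & C] ->
  (forall A, A \in H -> induced_connected e A) -> hits W H -> hits X H ->
  (forall Y, hits Y H -> #|X| <= #|Y|)%N ->
  (forall Z, L' Z = (#|Z| <= k)%N || ~~ hits Z (C |: H)) ->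
  (forall Z, L Z = (#|Z| <= k)%N || ~~ hits Z H) ->
  forall B U, branch e L' B U -> edges_into e (U :\: B) U -> W :&: U \subset B ->
  branch e L (B :&: C :|: X :&: U) (U :&: (C :|: X)).
Proof.
move=> Xk clC dCX dWC Hc WH XH Xmin defL' defL B U.
elim=> {}B {}U cs LB lk br IH dis defU clU WU.
(* [W] meets [U] only inside [B], and edges leave [U] only through [B]. *)
have meetB (D : {set T}) : induced_connected e D -> D :&: U != set0 -> W :&: D != set0 ->
    B :&: D != set0.
  move=> cD /set0Pn[z]; rewrite inE => /andP[zD zU] /set0Pn[w]; rewrite inE => /andP[wW wD].
  apply: contraT; rewrite negbK => /eqP BD.
  have nB y : y \in D -> y \notin B.
    by move=> yD; apply/negP=> yB; have := in_set0 y; rewrite -BD inE yB yD.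
  have DU : D \subset U.
    apply: (induced_connected_sub cD zD zU) => x y exy; rewrite !inE => /andP[xD xU].
    by rewrite (clU x y exy) ?orbT // inE nB.
  have := nB w wD; rewrite (subsetP WU) // inE wW; exact: (subsetP DU).
(* Minimality of [X] against [X :\: U :|: B :\: C] bounds [#|X :&: U|] by [#|B :\: C|]; then add
   [#|B :&: C|]. *)
have Bsmall : (#|B :&: C :|: X :&: U| <= #|B|)%N.
  have hitY : hits (X :\: U :|: B :\: C) H.
    apply/'forall_implyP => A AH; have cA := Hc A AH.
    have /set0Pn[x] := implyP (forallP XH A) AH; rewrite inE => /andP[xX xA].
    have /set0Pn[w] := implyP (forallP WH A) AH; rewrite inE => /andP[wW wA].
    have wC := disjointFr dWC wW.
    apply/set0Pn; apply: NNPP => none.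
    have AXU z : z \in A -> z \in X -> z \in U.
      by move=> zA zX; apply: contraT => zU; case: none; exists z; rewrite !inE zA zX zU.
    have ABC z : z \in A -> z \in B -> z \in C.
      by move=> zA zB; apply: contraT => zC; case: none; exists z; rewrite !inE zA zB zC orbT.
    (* [D] is the component of [w] in [A :\: C]. If it avoids [X], it is all of [A], because edges
       out of [C] end in [C] or [X]; but [A] meets [X]. Otherwise it meets [U], hence meets [B]
       outside [C]. *)
    pose Y := ~: (A :\: C); pose D := component e Y w.
    have wY : w \notin Y by rewrite !inE wA wC.
    have DA z : z \in D -> (z \in A) && (z \notin C).
      by move=> /(disjointFr (component_disjoint e wY)); rewrite !inE andbC => /negbT; rewrite negbK.
    have [DX|] := eqVneq (D :&: X) set0.
      have /subsetP/(_ x xA) xD : A \subset D.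
        apply: (induced_connected_sub cA wA (mem_component _ _ _)) => y z eyz.
        move=> /setIP[yA yD]; rewrite in_setU in_setC; case: (boolP (z \in A)) => //= zA.
        have := component_edges wY eyz yD; rewrite in_setU => /orP[//|].
        rewrite !inE zA andbT negbK => zC.
        have := clC z y; rewrite e_sym inE => /(_ eyz zC) /orP[yC|yX].
          by have := DA y yD; rewrite yC andbF.
        by have := in_set0 y; rewrite -DX inE yD yX.
      by have := in_set0 x; rewrite -DX inE xD xX.
    move=> /set0Pn[z]; rewrite inE => /andP[zD zX]; have /andP[zA _] := DA z zD.
    have : B :&: D != set0.
      apply: meetB; first exact: component_connected.
        by apply/set0Pn; exists z; rewrite inE zD AXU.
      by apply/set0Pn; exists w; rewrite inE wW mem_component.
    case/set0Pn=> b; rewrite inE => /andP[bB bD]; have /andP[bA /negP] := DA b bD.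
    by apply; apply: ABC.
  have := Xmin _ hitY; have := cardsID C B; have := cardsID U X.
  have := cardsUI (X :\: U) (B :\: C); have := cardsUI (B :&: C) (X :&: U).
  by lia.
exists [set (c.1 :&: C :|: X :&: c.2, c.2 :&: (C :|: X)) | c in cs].
(* If the new bag exceeds [k], so does [B], which then misses a member [A] of [C |: H]. This is not
   [C], or the new bag would lie in [X]; so [A] is in [H], and by [meetB] the new bag misses it
   too. *)
- rewrite defL; case: (leqP #|B :&: C :|: X :&: U| k) => //= big.
  have := LB; rewrite defL' leqNgt (leq_trans big Bsmall) /= => /forallPn[A].
  rewrite negb_imply negbK => /andP[/setU1P[->|AH] /eqP BA].
    by move: big; rewrite BA set0U ltnNge (leq_trans (subset_leq_card (subsetIl _ _))).
  apply/forallPn; exists A; rewrite negb_imply AH negbK /= -subset0.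
  apply/subsetP=> z; rewrite in_set0 !inE => /andP[/orP[/andP[zB _]|/andP[_ zU]] zA].
    by have := in_set0 z; rewrite -BA inE zB zA.
  have AU : A :&: U != set0 by apply/set0Pn; exists z; rewrite inE zA.
  by have := meetB A (Hc A AH) AU (implyP (forallP WH A) AH); rewrite BA eqxx.
- move=> _ /imsetP[c cc ->] /=; have [cB clc clcB] := lk c cc.
  have cU : c.2 \subset U.
    by rewrite defU; apply: subset_trans (bigcup_sup _ cc) (subsetUr _ _).
  split.
  + apply/subsetP=> z; rewrite !inE.
    case zX: (z \in X); case zc: (z \in c.2); rewrite //= ?orbT //= ?orbF.
    case zC: (z \in C); rewrite ?andbF //= ?andbT => zB.
    by apply: (subsetP cB); rewrite inE zc.
  + move=> x y exy; rewrite !inE.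
    case xX: (x \in X); case xc: (x \in c.2); rewrite //= ?orbT ?andbF //= ?orbF.
    case xC: (x \in C); rewrite ?andbF //= ?andbT => xc1.
    have := clC x y exy xC; rewrite inE => ->; rewrite andbT.
    by apply: (clc x y exy); rewrite inE xc1 xc.
  + move=> x y exy; rewrite !inE.
    case xX: (x \in X); case xc: (x \in c.2); rewrite //= ?orbT ?andbF //= ?(subsetP cU x xc) ?orbT //=.
    rewrite ?orbF; case xC: (x \in C); rewrite ?andbF //= ?andbT => xB.
    have := clC x y exy xC; rewrite !inE => yCX; rewrite yCX andbT.
    have := clcB x y exy; rewrite !inE xc xB => /(_ isT) /orP[-> //|yB].
    have yU : y \in U by rewrite defU inE yB.
    by case/orP: yCX => ->; rewrite ?yB ?yU !orbT.
- move=> _ /imsetP[c cc ->] /=; have [cB clc _] := lk c cc.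
  apply: IH => //; apply/subsetP=> z; rewrite inE => /andP[zW zc].
  have zU : z \in U by rewrite defU inE; apply/orP; right; apply/bigcupP; exists c.
  by apply: (subsetP cB); rewrite inE zc; apply: (subsetP WU); rewrite inE zW.
- move=> _ _ /imsetP[c cc ->] /imsetP[d dd ->] /= cd.
  have {}cd : c != d by apply: contraNneq cd => ->.
  apply/subsetP=> z; rewrite !inE => /andP[/andP[zc zCX] /andP[zd _]].
  have zB : z \in B by apply: (subsetP (dis c d cc dd cd)); rewrite inE zc.
  have zU : z \in U by rewrite defU inE zB.
  by rewrite zB zU andbT.
- apply/setP=> z; apply/idP/idP; rewrite !inE.
    case/andP=> zU zCX; move: (zU); rewrite {1}defU inE => /orP[zB|/bigcupP[c cc zc]].
      by rewrite zB zU andbT zCX.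
    apply/orP; right; apply/bigcupP.
    exists (c.1 :&: C :|: X :&: c.2, c.2 :&: (C :|: X)); first by apply/imsetP; exists c.
    by rewrite !inE zc.
  case/orP=> [/orP[/andP[zB ->]|/andP[-> ->]]|/bigcupP[_ /imsetP[c cc ->]]].
  + by rewrite defU inE zB.
  + by rewrite orbT.
  rewrite !inE => /andP[zc ->]; rewrite andbT defU inE; apply/orP; right.
  by apply/bigcupP; exists c.
Qed.
End Branches.

Section Duality.
Variables (T : finType) (e : rel T).
Hypothesis e_sym : symmetric e.
Implicit Types (L : pred {set T}) (B U P Q X C W S Y : {set T}) (H F : {set {set T}}).

Lemma hitsP X H : reflect (forall A, A \in H -> X :&: A != set0) (hits X H).
Proof. by apply: (iffP forallP) => h A; [apply/implyP | apply/implyP/h]. Qed.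

Lemma thicketP H : reflect
  [/\ forall A, A \in H -> A != set0, forall A, A \in H -> induced_connected e A
    & forall A D, A \in H -> D \in H -> A :&: D != set0] (thicket e H).
Proof.
apply: (iffP andP) => [[/'forall_implyP h1 /'forall_implyP h2]|[h1 h2 h3]].
  split=> [A /h1/andP[]|A /h1/andP[]|A D /h2/'forall_implyP] //; exact.
split; apply/'forall_implyP => A AH; first by rewrite h1 ?h2.
by apply/'forall_implyP => D DH; apply: h3.
Qed.

Lemma min_hitting_set H : thicket e H ->
  exists X, [/\ hits X H, #|X| = hitting_size H & forall Y, hits Y H -> (#|X| <= #|Y|)%N].
Proof.
move=> /thicketP[H0 _ _].
have hT : hits setT H by apply/hitsP => A /H0; rewrite setTI.
case: (@arg_minnP _ _ (fun X => hits X H) (fun X : {set T} => #|X|) hT) => X hX minX; exists X; split=> //.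
apply/eqP; rewrite eqn_leq; apply/andP; split.
  apply: (big_ind (fun m => #|X| <= m)%N) => [|m n ? ?|//]; first exact: max_card.
  by rewrite leq_min; apply/andP.
rewrite /hitting_size; elim: (index_enum _) (mem_index_enum X) => // Z r IHr.
rewrite inE big_cons => /orP[/eqP <-|/IHr IH]; first by rewrite hX geq_minl.
by case: ifP => // _; rewrite geq_min IH orbT.
Qed.

(* After Bellenbaum and Diestel's proof of the treewidth duality theorem. *)
Lemma thicket_branch k H : (forall H', thicket e H' -> (hitting_size H' <= k)%N) ->
  thicket e H ->
  exists B, branch e (fun Z => (#|Z| <= k)%N || ~~ hits Z H) B setT.
Proof.
(* Induction on the number of sets outside [H]: the claim is known for larger thickets. *)
move=> Hk; have [n] := ubnP (#|{set T}| - #|H|)%N.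
elim: n H => // n IHn H; rewrite ltnS => le_n tH.
have [X [XH cardX Xmin]] := min_hitting_set tH.
have Xk : (#|X| <= k)%N by rewrite cardX Hk.
have [H0 Hc Hint] := thicketP _ tH.
pose L : pred {set T} := fun Z => (#|Z| <= k)%N || ~~ hits Z H.
(* By contradiction, since re-rooting may already produce a decomposition for [H]. *)
apply: NNPP => noL.
pose comps := [set component e X a | a in ~: X].
(* For each component [C] of the complement of [X], choose branches that cover [C], stay in
   [C :|: X] and can hang below [X]. *)
have [C|QQ hQ] := @fin_all_exists {set T} (fun=> {set {set T} * {set T}}) (fun (C : {set T}) (Q : {set {set T} * {set T}}) => C \in comps ->
    [/\ forall q, q \in Q -> [/\ link e X q.1 q.2, branch e L q.1 q.2 & q.2 \subset C :|: X],
        forall c d, c \in Q -> d \in Q -> c != d -> c.2 :&: d.2 \subset X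
      & C \subset \bigcup_(q in Q) q.2]).
  case: (boolP (C \in comps)) => [/imsetP[a]|_]; last by exists set0.
  rewrite inE => aX defC.
  have dCX : [disjoint C & X] by rewrite defC; apply: component_disjoint.
  have clC : edges_into e C (C :|: X) by rewrite defC; apply: component_edges.
  have cC : induced_connected e C by rewrite defC; apply: component_connected.
  have aC : a \in C by rewrite defC mem_component.
  (* If [C] does not hit [H], the single bag [C] is admissible. Otherwise [C] can be added to the
     thicket; it is new because [X] misses it. *)
  case: (boolP (hits C H)) => [/hitsP CH|nCH]; last first.
    exists [set (C, C)] => _; split.
    - move=> _ /set1P -> /=; split; last exact: subsetUl.
        split; first exact: subsetIl.
          by move=> x y _; rewrite setDv inE.
        by move=> x y exy /setDP[xC _]; apply: clC xC.
      exists set0 => [|||c d|]; rewrite ?inE //.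
      + by rewrite /L nCH orbT.
      + by move=> c; rewrite inE.
      + by move=> c; rewrite inE.
      + by rewrite big_set0 setU0.
    - by move=> c d /set1P -> /set1P ->; rewrite eqxx.
    - by rewrite big_set1.
  have CnH : C \notin H.
    apply/negP=> /(hitsP _ _ XH); rewrite setIC; move: dCX; rewrite -setI_eq0 => /eqP ->.
    by rewrite eqxx.
  have tCH : thicket e (C |: H).
    apply/thicketP; split=> [A /setU1P[->|/H0 //]|A /setU1P[->//|/Hc //]|A D].
      by apply/set0Pn; exists a.
    move=> /setU1P[->|AH] /setU1P[->|DH]; rewrite ?setIid.
    + by apply/set0Pn; exists a.
    + exact: CH.
    + by rewrite setIC CH.
    + exact: Hint.
  have [|B' brB'] := IHn _ _ tCH.
    have := max_card (mem (C |: H)); rewrite cardsU1 CnH add1n => ltH.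
    by apply: leq_trans le_n; rewrite subnS prednK // subn_gt0.
  (* The decomposition for [C |: H] serves for [H] unless some bag [W] has more than [k] vertices
     and hits [H]. Then [W] misses [C], and the tree re-rooted at [W] is transformed into branches
     below [X]. *)
  have [|||||brL|] := branch_reroot e_sym L (Q := set0) brB'.
  - by move=> q; rewrite inE.
  - by move=> q; rewrite inE.
  - by move=> q d; rewrite inE.
  - by move=> q; rewrite inE.
  - by rewrite big_set0 setU0.
  - by case: noL; exists B'.
  move=> [W [LW]]; rewrite negb_or negbK -ltnNge => /andP[bigW WH] brW.
  have dWC : [disjoint W & C].
    move: LW; rewrite leqNgt bigW /= => /forallPn[A].
    rewrite negb_imply negbK => /andP[/setU1P[->|AH]]; first by rewrite setI_eq0.
    by rewrite (negbTE (hitsP _ _ WH A AH)).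
  have tr := branch_transform e_sym (L := L) Xk clC dCX dWC Hc WH XH Xmin (frefl _) (frefl _).
  case: brW => cs _ lk br dis covW.
  exists [set (c.1 :&: C :|: X :&: c.2, c.2 :&: (C :|: X)) | c in cs] => _; split.
  - move=> _ /imsetP[c cc ->] /=; have [cW clc clcW] := lk c cc.
    split; [|apply: tr => //; [exact: br|by rewrite setIC]|exact: subsetIr].
    have CX z : z \in C -> (z \in X) = false by move=> /(disjointFr dCX).
    split.
    + by apply/subsetP=> z; rewrite !inE => /andP[/andP[-> _] ->]; rewrite orbT.
    + move=> x y exy; rewrite !inE.
      case xX: (x \in X); case xc: (x \in c.2); rewrite //= ?orbT ?andbF //= ?orbF.
      case xC: (x \in C); rewrite ?andbF //= ?andbT => xc1.
      have := clC x y exy xC; rewrite inE => ->; rewrite andbT.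
      by apply: (clc x y exy); rewrite inE xc1 xc.
    + move=> x y exy; rewrite !inE => /andP[xX /andP[xc]]; rewrite (negbTE xX) orbF => xC.
      have := clC x y exy xC; rewrite !inE => /orP[yC|->]; last by rewrite orbT.
      have := clcW x y exy; rewrite !inE xc (disjointFl dWC xC) yC (disjointFl dWC yC) !orbF.
      by move=> /(_ isT) ->.
  - move=> _ _ /imsetP[c cc ->] /imsetP[d dd ->] /= cd.
    have {}cd : c != d by apply: contraNneq cd => ->.
    apply/subsetP=> z; rewrite !inE => /andP[/andP[zc zCX] /andP[zd _]].
    have zW : z \in W by apply: (subsetP (dis c d cc dd cd)); rewrite inE zc.
    by case/orP: zCX => // zC; rewrite (disjointFl dWC zC) in zW.
  - apply/subsetP=> z zC; have : z \in [set: T] by [].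
    rewrite covW inE (disjointFl dWC zC) /= => /bigcupP[c cc zc]; apply/bigcupP.
    exists (c.1 :&: C :|: X :&: c.2, c.2 :&: (C :|: X)); first by apply/imsetP; exists c.
    by rewrite !inE zc zC.
apply: noL; exists X; exists (\bigcup_(C in comps) QQ C).
- by rewrite /L Xk.
- by move=> q /bigcupP[C CC qC]; have [/(_ q qC)[]] := hQ C CC.
- by move=> q /bigcupP[C CC qC]; have [/(_ q qC)[]] := hQ C CC.
- move=> c d /bigcupP[C CC cC] /bigcupP[D DD dD] cd.
  have [hC disC _] := hQ C CC; have [hD _ _] := hQ D DD.
  have [CD|nCD] := eqVneq C D; first by apply: disC; rewrite // CD.
  have [_ _ /subsetP cX] := hC c cC; have [_ _ /subsetP dX] := hD d dD.
  apply/subsetP=> z; rewrite inE => /andP[/cX + /dX]; rewrite !inE.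
  case: (z \in X); rewrite ?orbT // !orbF => zC zD; case/eqP: nCD.
  case/imsetP: CC zC => a _ ->; case/imsetP: DD zD => b _ -> zb za.
  by rewrite -(component_eq e_sym za) (component_eq e_sym zb).
- apply/esym/setP=> z; rewrite !inE; case: (boolP (z \in X)) => //= zX.
  have CC : component e X z \in comps by apply/imsetP; exists z; rewrite ?inE.
  have [_ _ /subsetP/(_ z (mem_component _ _ _))/bigcupP[q qQ zq]] := hQ _ CC.
  by apply/bigcupP; exists q => //; apply/bigcupP; exists (component e X z).
Qed.

(** The duality is applied to the empty thicket, which every set hits, so that all bags have at most
    [thicket_number e] vertices. *)
Lemma small_set_hits_neighbours F : (forall S, S \in F -> S != set0 /\ induced_connected e S) ->
  F != set0 ->
  exists S Y, [/\ S \in F, (#|Y| <= thicket_number e)%N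
    & forall S', S' \in F -> S' :&: S != set0 -> Y :&: S' != set0].
Proof.
move=> Fc /set0Pn[S0 S0F].
have [||B br] := @thicket_branch (thicket_number e) set0.
- by move=> H tH; exact: (@leq_bigmax_cond _ (thicket e) (@hitting_size T) H tH).
- by apply/thicketP; split=> [A|A|A D]; rewrite inE.
have [||S [Y [SF + hY]]] := branch_separates br _ Fc.
- by move=> x y; rewrite !inE.
- by exists S0; rewrite ?subsetT.
case/orP=> [Yk|/negP[]]; first by exists S, Y.
by apply/hitsP => A; rewrite inE.
Qed.
End Duality.

(** * Packing and covering by local ratio *)

(** Pay [v S] on each vertex of [Y] and solve the residual game [w]. This costs at most
    [thicket_number e * v S], and the packing gains at least [v S]: either [S] is disjoint from its
    members and joins it, or some member meets [S] and is worth at least [v S] more under [v] than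
    under [w]. *)
Lemma packing_covering (T : finType) (e : rel T) (v : {set T} -> nat) : symmetric e ->
  v set0 = 0%N -> (forall S, ~~ induced_connected e S -> v S = 0%N) ->
  exists (x : T -> nat) (M : {set {set T}}), [/\ int_feasible v x, trivIset M,
    (\sum_i x i <= thicket_number e * \sum_(S in M) v S)%N & forall S, S \in M -> v S != 0%N].
Proof.
move=> e_sym; have [n] := ubnP #|[set S | v S != 0%N]|.
elim: n v => // n IHn v; rewrite ltnS => le_n v0 vc.
have [F0|F0] := eqVneq [set S | v S != 0%N] set0.
  exists (fun=> 0%N), set0; split.
  - move=> S; rewrite big1 // leqn0; apply: contraT => vS.
    by have := in_set0 S; rewrite -F0 inE vS.
  - by apply/trivIsetP => A D; rewrite inE.
  - by rewrite big1.
  - by move=> S; rewrite inE.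
have [|S [Y [SF Yk hY]]] := @small_set_hits_neighbours T e e_sym [set S | v S != 0%N] _ F0.
  move=> S; rewrite inE => vS; split; first by apply: contraNneq vS => ->; rewrite v0.
  by apply: contraNT vS => /vc ->.
rewrite inE in SF; pose w D := (v D - v S * #|Y :&: D|)%N.
have wv D : (w D <= v D)%N by apply: leq_subr.
have w_hit D : w D != 0%N -> D :&: S != set0 -> (w D + v S <= v D)%N.
  rewrite /w => wD DS; have hD : (0 < #|Y :&: D|)%N.
    by rewrite card_gt0 hY // inE; apply: contraNneq wD => ->; rewrite sub0n.
  by have := leq_pmulr (v S) hD; lia.
have w0 D : v D = 0%N -> w D = 0%N by rewrite /w => ->.
have [|||x [M [xw tM leM Mw]]] := IHn w.
(* The support shrinks: [S] meets itself, so [w_hit] forces [w S = 0]. *)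
- apply: leq_trans le_n; apply: proper_card; apply/properP; split.
    by apply/subsetP=> D; rewrite !inE; apply: contraNneq => /w0 ->.
  exists S; rewrite !inE // negbK; apply: contraT => wS.
  have SS : S :&: S != set0.
    by rewrite setIid; apply: contraNneq SF => ->; rewrite v0.
  by have := w_hit S wS SS; move: wS; lia.
- exact: w0.
- by move=> D /vc; apply: w0.
have Mv D : D \in M -> v D != 0%N by move=> /Mw; apply: contraNneq => /w0 ->.
have cardE (Z : {set T}) : (\sum_i (i \in Z) = #|Z|)%N.
  by rewrite -sum1_card [RHS]big_mkcond; apply: eq_bigr => i _; case: (_ \in _).
have costE : (\sum_i (x i + v S * (i \in Y)) = \sum_i x i + v S * #|Y|)%N.
  by rewrite big_split /= -big_distrr cardE.
have feas : int_feasible v (fun i => x i + v S * (i \in Y))%N.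
  move=> D; rewrite big_split /= -big_distrr /=.
  have -> : (\sum_(i in D) (i \in Y) = #|Y :&: D|)%N.
    rewrite -cardE big_mkcond; apply: eq_bigr => i _.
    by rewrite inE; do 2!case: (_ \in _).
  by have := xw D; rewrite /w; lia.
have [/forallP dis|] := boolP [forall D, (D \in M) ==> [disjoint S & D]].
  have [||tSM SM] := trivIsetU1 (A := S) (P := M) _ tM.
  - by move=> D; apply/implyP.
  - by apply/negP=> /Mv; rewrite v0.
  exists (fun i => x i + v S * (i \in Y))%N, (S |: M); split=> //.
    rewrite costE big_setU1 //= mulnDr addnC; apply: leq_add; first by rewrite mulnC leq_mul2r Yk orbT.
    by apply: leq_trans leM _; rewrite leq_mul2l leq_sum ?orbT.
  by move=> D /setU1P[->|/Mv].
move=> /forallPn[D]; rewrite negb_imply -setI_eq0 setIC => /andP[DM DS].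
exists (fun i => x i + v S * (i \in Y))%N, M; split=> //.
have : (v S + \sum_(D in M) w D <= \sum_(D in M) v D)%N.
  rewrite (bigD1 D) //= [leqRHS](bigD1 D) //= addnA; apply: leq_add; last exact: leq_sum.
  by rewrite addnC w_hit // Mw.
move=> le; rewrite costE; apply: leq_trans (leq_mul (leqnn _) le).
rewrite mulnDr addnC; apply: leq_add leM; by rewrite mulnC leq_mul2r Yk orbT.
Qed.

Lemma packing_bound (R : realFieldType) (T : finType) (v : {set T} -> nat) (x : T -> R)
    (M : {set {set T}}) :
  frac_feasible v x -> trivIset M -> (\sum_(S in M) v S)%:R <= \sum_i x i.
Proof.
move=> [x0 xv] tM; rewrite natr_sum.
apply: le_trans (_ : \sum_(i in cover M) x i <= _).
  by rewrite big_trivIset //=; apply: ler_sum.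
rewrite [leRHS](bigID (mem (cover M))) /= lerDl; exact: sumr_ge0.
Qed.

(** * Attainment of the two minima *)

Section LinearProgram.
Variables (R : realFieldType) (T : finType) (v : {set T} -> nat).
Implicit Types (x y d : T -> R) (S : {set T}).

Definition covers x := [forall S : {set T}, (v S)%:R <= \sum_(i in S) x i].
Definition tight x := [set S : {set T} | \sum_(i in S) x i == (v S)%:R].
(** For feasible [x]: a vertex of the polyhedron, the tight constraints having full rank. *)
Definition basic x := forall d, (forall S, S \in tight x -> \sum_(i in S) d i = 0) -> forall i, d i = 0.

(* Nonnegativity is already the constraint of the singletons. *)
Lemma frac_feasibleP x : frac_feasible v x <-> covers x.
Proof.
split=> [[_ h]|/forallP h]; first exact/forallP.
by split=> // i; have := h [set i]; rewrite big_set1; apply: le_trans; apply: ler0n.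
Qed.

(** This leaves finitely many vertices, one at most for each family of sets. *)
Lemma basic_eq x y : basic x -> tight x = tight y -> x =1 y.
Proof.
move=> bx txy i; apply/subr0_eq; apply: (bx (fun i => x i - y i)) => S Sx.
have := Sx; rewrite {1}txy !inE sumrB in Sx * => /eqP ->; by move: Sx => /eqP ->; rewrite subrr.
Qed.

(** Move along a direction that keeps the tight sums and does not raise the total, until a further
    constraint becomes tight. *)
Lemma nonbasic_improve x : covers x -> ~ basic x ->
  exists y, [/\ covers y, \sum_i y i <= \sum_i x i & (#|tight x| < #|tight y|)%N].
Proof.
move=> /forallP cx nb.
(* One of [d] and [- d] serves. The negative coordinate makes the constraint of a singleton
   decrease, so the motion must stop. *)
have [d [d0 dneg dsum]] : exists d, [/\ forall S, S \in tight x -> \sum_(i in S) d i = 0,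
    exists i, d i < 0 & \sum_i d i <= 0].
  have [d [d0 [i di]]] : exists d, (forall S, S \in tight x -> \sum_(i in S) d i = 0) /\
      exists i, d i != 0.
    apply: NNPP => none; apply: nb => d d0 i; apply/eqP; apply: contraT => di.
    by case: none; exists d; split=> //; exists i.
  have opp S : \sum_(j in S) - d j = - \sum_(j in S) d j by rewrite sumrN.
  have [lt|gt|eq] := ltgtP (\sum_i d i) 0.
  - exists d; split; [by []| |exact: ltW].
    apply: NNPP => none; move: lt; rewrite ltNge sumr_ge0 // => j _; rewrite leNgt.
    by apply/negP=> dj; case: none; exists j.
  - exists (fun j => - d j); split; first by move=> S /d0; rewrite opp => ->; rewrite oppr0.
      apply: NNPP => none; move: gt; rewrite ltNge sumr_le0 // => j _; rewrite leNgt.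
      by apply/negP=> dj; case: none; exists j; rewrite oppr_lt0.
    by rewrite sumrN oppr_le0 ltW.
  - have [lti|gti|] := ltgtP (d i) 0; last by move/eqP; rewrite (negbTE di).
      by exists d; split=> //; [exists i | rewrite eq].
    exists (fun j => - d j); split; first by move=> S /d0; rewrite opp => ->; rewrite oppr0.
      by exists i; rewrite oppr_lt0.
    by rewrite sumrN eq oppr0.
have [i0 di0] := dneg.
pose P S := \sum_(i in S) d i < 0.
have P0 : P [set i0] by rewrite /P big_set1.
(* The step length at which [S] becomes tight; the least one over the decreasing constraints is
   taken. *)
pose q S := (\sum_(i in S) x i - (v S)%:R) / - \sum_(i in S) d i.
case: (@arg_minP _ _ _ _ P q P0) => S0 PS0 minS0.
have l0 : 0 <= q S0 by rewrite divr_ge0 ?subr_ge0 // oppr_ge0 ltW.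
have sumE S : \sum_(i in S) (x i + q S0 * d i) = \sum_(i in S) x i + q S0 * \sum_(i in S) d i.
  by rewrite big_split /= mulr_sumr.
exists (fun i => x i + q S0 * d i); split.
- apply/forallP => S; rewrite sumE; have [PS|] := ltP (\sum_(i in S) d i) 0.
    have := minS0 S PS; rewrite {2}/q ler_pdivlMr ?oppr_gt0 //; lra.
  by move=> dS; apply: le_trans (cx S) _; rewrite lerDl mulr_ge0.
- have -> : \sum_i (x i + q S0 * d i) = \sum_i x i + q S0 * \sum_i d i.
    by rewrite big_split /= mulr_sumr.
  by rewrite gerDl mulr_ge0_le0.
apply: proper_card; apply/properP; split.
  apply/subsetP=> S Sx; have := Sx; rewrite !inE sumE d0 // mulr0 addr0.
  by [].
exists S0; last by apply/negP=> /d0 E; move: PS0; rewrite /P E ltxx.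
rewrite inE sumE /q; have dS0 : \sum_(i in S0) d i != 0 by rewrite lt_eqF.
by apply/eqP; field.
Qed.

Lemma basic_below x : covers x -> exists y, [/\ covers y, basic y & \sum_i y i <= \sum_i x i].
Proof.
have [n] := ubnP (#|{set T}| - #|tight x|)%N; elim: n x => // n IHn x; rewrite ltnS => le_n cx.
case: (classic (basic x)) => [bx|nbx]; first by exists x; rewrite lexx.
have [y [cy ley lty]] := nonbasic_improve cx nbx.
have [||z [cz bz lez]] := IHn y.
- have le1 : (#|tight y| <= #|{set T}|)%N by apply: max_card.
  apply: leq_trans le_n; apply: ltn_sub2l => //; exact: leq_trans le1.
- by [].
by exists z; split=> //; apply: le_trans ley.
Qed.

Lemma kappaf_exists x0 : covers x0 -> exists k : R, is_kappaf v k.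
Proof.
move=> cx0.
(* [u] picks a vertex for each tight family that occurs, so the minimum can be taken over the finite
   type of families. *)
have [K|u hu] := @fin_all_exists {set {set T}} (fun=> T -> R)
    (fun K x => (exists y, basic y /\ tight y = K) -> basic x /\ tight x = K).
  by case: (classic (exists y, basic y /\ tight y = K)) => [[y hy]|?]; [exists y | exists x0].
have uE y : basic y -> u (tight y) =1 y.
  move=> by_; have [|bu tu] := hu (tight y); first by exists y.
  exact: basic_eq.
have sumE y : basic y -> \sum_i u (tight y) i = \sum_i y i.
  by move=> by_; apply: eq_bigr => i _; rewrite uE.
have covE y : basic y -> covers y -> covers (u (tight y)).
  move=> by_ /forallP cy; apply/forallP => S; apply: le_trans (cy S) _.
  by rewrite le_eqVlt; apply/orP; left; apply/eqP/eq_bigr => i _; rewrite uE.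
have [y0 [cy0 by0 _]] := basic_below cx0.
have := @arg_minP _ _ _ _ (fun K => covers (u K)) (fun K => \sum_i u K i) (covE _ by0 cy0).
case=> K cK minK; exists (\sum_i u K i); split; first by exists (u K); split=> //; apply/frac_feasibleP.
move=> x /frac_feasibleP cx; have [y [cy by_ ley]] := basic_below cx.
by apply: le_trans ley; rewrite -(sumE y by_); apply: minK; apply: covE.
Qed.
End LinearProgram.

(** Weights of total [k] are at most [k], so they range over a finite type; this makes attaining the
    total [k] decidable, and a least such [k] exists. *)
Lemma kappa_exists (T : finType) (v : {set T} -> nat) (x0 : T -> nat) :
  int_feasible v x0 -> exists k, is_kappa v k.
Proof.
move=> fx0; pose P k := [exists x : {ffun T -> 'I_k.+1},
  [forall S : {set T}, (v S <= \sum_(i in S) x i)%N] && (\sum_i x i == k)%N].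
have PP x : int_feasible v x -> P (\sum_i x i)%N.
  move=> fx; have lex i : (x i < (\sum_i x i).+1)%N by rewrite ltnS (bigD1 i) //= leq_addr.
  apply/existsP; exists [ffun i => Ordinal (lex i)]; apply/andP; split.
    by apply/forallP => S; apply: leq_trans (fx S) _; apply: leq_sum => i _; rewrite ffunE.
  by apply/eqP/eq_bigr => i _; rewrite ffunE.
have exP : exists k, P k by exists (\sum_i x0 i)%N; apply: PP.
case: (ex_minnP exP) => k Pk mink; exists k; split; last by move=> x /PP /mink.
case/existsP: Pk => x /andP[/forallP fx /eqP sx].
by exists (fun i => x i : nat); split.
Qed.

(** * The two bounds on the ratio *)

Lemma coalition_game_gap (R : realFieldType) (T : finType) (e : rel T) (v : {set T} -> nat) :
  symmetric e -> coalition_game e v ->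
  exists (k : nat) (kf : R), [/\ is_kappa v k, is_kappaf v kf, 0 < kf
    & k%:R <= (thicket_number e)%:R * kf].
Proof.
move=> e_sym [v0 vc [S /eqP vS]].
have [x [M [fx tM leM _]]] := packing_covering e_sym v0 vc.
have [k hk] := kappa_exists fx.
have cx : covers v (fun i => (x i)%:R : R).
  by apply/forallP => D; rewrite -natr_sum ler_nat.
have [kf hkf] := kappaf_exists cx; exists k, kf; split=> //.
  have [[y [fy <-]] _] := hkf.
  (* A single coalition of positive value is a packing, whence [0 < kf]. *)
  have tS : trivIset [set S].
    by apply/trivIsetP => A D /set1P -> /set1P ->; rewrite eqxx.
  by apply: lt_le_trans (packing_bound fy tS); rewrite big_set1 ltr0n lt0n.
have [[y [fy <-]] _] := hkf; have [_ /(_ x fx) lek] := hk.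
apply: le_trans (_ : (thicket_number e * \sum_(S in M) v S)%:R <= _).
  by rewrite ler_nat (leq_trans lek).
by rewrite natrM ler_wpM2l // packing_bound.
Qed.

Lemma thicket_number_gt0 (T : finType) (e : rel T) : (0 < #|T|)%N -> (0 < thicket_number e)%N.
Proof.
move=> /card_gt0P[a _]; have tH : thicket e [set [set a]].
  apply/thicketP; split=> [A|A|A D] /set1P ->; first by apply/set0Pn; exists a; rewrite inE.
    apply/'forall_implyP => x /set1P ->; apply/'forall_implyP => y /set1P ->; exact: connect0.
  by move=> /set1P ->; apply/set0Pn; exists a; rewrite !inE eqxx.
apply: leq_trans (@leq_bigmax_cond _ (thicket e) (@hitting_size T) _ tH).
have [X [/hitsP hX <- _]] := min_hitting_set tH.
have /set0Pn[x] := hX [set a] (set11 _); rewrite inE => /andP[xX _].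
by apply/card_gt0P; exists x.
Qed.

(** The members of the thicket that avoid [Y] pairwise intersect, so one component [C] of the
    complement of [Y] contains them all. Then [C :&: X] together with [Y] hits the thicket, and as
    [Y] has fewer than half of the required vertices, [C :&: X] has more than half. *)
Lemma thicket_number_balanced (T : finType) (e : rel T) : symmetric e ->
  exists X : {set T}, #|X| = thicket_number e /\
    forall Y : {set T}, (#|Y|.*2 < thicket_number e)%N ->
    exists S, [/\ induced_connected e S, [disjoint S & Y]
      & (thicket_number e < #|S :&: X|.*2)%N].
Proof.
move=> e_sym.
have [|H tH tauH] := @eq_bigmax_cond _ (thicket e) (@hitting_size T).
  by apply/card_gt0P; exists set0; apply/thicketP; split=> [A|A|A D]; rewrite inE.
have [X [XH cardX Xmin]] := min_hitting_set tH.
have tauX : #|X| = thicket_number e by rewrite cardX -tauH.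
exists X; split=> // Y ltY; have [_ Hc Hint] := thicketP _ _ tH.
have /forallPn[A] : ~~ hits Y H by apply/negP=> /Xmin; move: ltY; rewrite -tauX; lia.
rewrite negb_imply negbK => /andP[AH /eqP YA].
have /set0Pn[a] := hitsP _ _ XH A AH; rewrite inE => /andP[_ aA].
have subC A' : A' \in H -> Y :&: A' = set0 -> A' \subset component e Y a.
  move=> A'H YA'; have /set0Pn[b] := Hint A A' AH A'H; rewrite inE => /andP[bA bA'].
  have dis B : Y :&: B = set0 -> [disjoint B & Y] by rewrite setIC -setI_eq0 => ->.
  have bC := subsetP (induced_connected_component (Hc A AH) aA (dis A YA)) b bA.
  rewrite -(component_eq e_sym bC).
  exact: induced_connected_component (Hc A' A'H) bA' (dis A' YA').
have aY : a \notin Y by apply/negP=> aY; have := in_set0 a; rewrite -YA inE aY aA.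
exists (component e Y a); split; [exact: component_connected | exact: component_disjoint|].
have : hits ((component e Y a :&: X) :|: Y) H.
  apply/hitsP => A' A'H; have [YA'|] := eqVneq (Y :&: A') set0.
    have /set0Pn[x] := hitsP _ _ XH A' A'H; rewrite inE => /andP[xX xA'].
    apply/set0Pn; exists x; rewrite !(in_setI, in_setU) xX xA'.
    by rewrite (subsetP (subC A' A'H YA') x xA').
  move=> /set0Pn[x]; rewrite inE => /andP[xY xA']; apply/set0Pn; exists x.
  by rewrite !(in_setI, in_setU) xY xA' orbT.
move=> /Xmin /leq_trans/(_ (leq_card_setU _ _)); move: ltY; rewrite -tauX; lia.
Qed.

Theorem theorem2 (R : realFieldType) (T : finType) (e : rel T)
    (e_sym : symmetric e) (e_irr : irreflexive e) (V_nonempty : (0 < #|T|)%N) :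
  (forall v : {set T} -> nat, coalition_game e v ->
     exists (k : nat) (kf : R), [/\ is_kappa v k, is_kappaf v kf &
       k%:R / kf <= (thicket_number e)%:R])
  /\
  (exists v : {set T} -> nat, coalition_game e v /\
     exists (k : nat) (kf : R), [/\ is_kappa v k, is_kappaf v kf &
       (thicket_number e)%:R / 4 <= k%:R / kf]).
Proof.
split=> [v gv|].
  have [k [kf [hk hkf kf0 le]]] := coalition_game_gap R e_sym gv.
  by exists k, kf; split=> //; rewrite ler_pdivrMr.
have [X [cardX hX]] := thicket_number_balanced e_sym.
have tau0 := thicket_number_gt0 e V_nonempty; set tau := thicket_number e in hX cardX tau0 *.
pose v (S : {set T}) : nat := induced_connected e S && (tau < #|S :&: X|.*2)%N.
have gv : coalition_game e v.
  split; first by rewrite /v set0I cards0 andbF.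
    by move=> S; rewrite /v => /negbTE ->.
  have [|S [cS _ XS]] := hX set0; first by rewrite cards0.
  by exists S; rewrite /v cS XS.
have [k [kf [hk hkf kf0 _]]] := coalition_game_gap R e_sym gv.
exists v; split=> //; exists k, kf; split=> //.
have tauR : 0 < tau%:R :> R by rewrite ltr0n.
have le_k : (tau <= k.*2)%N.
  (* The support [Y] of an optimal integral [x] has at most [k] vertices; a coalition avoiding it
     would receive weight 0. *)
  have [[x [fx <-]] _] := hk; pose Y := [set i | 0 < x i]%N.
  have leY : (#|Y| <= \sum_i x i)%N.
    rewrite -sum1_card big_mkcond; apply: leq_sum => i _.
    by rewrite inE; case: ifP.
  rewrite leqNgt; apply/negP=> lt.
  have [|S [cS dSY XS]] := hX Y; first by apply: leq_ltn_trans lt; rewrite leq_double.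
  have := fx S; rewrite /v cS XS big1 // => i iS.
  by have := disjointFr dSY iS; rewrite inE lt0n => /negbFE/eqP.
have le_kf : kf <= 2.
  have sumX (S : {set T}) :
      \sum_(i in S) (if i \in X then 2 / tau%:R else 0) = #|S :&: X|%:R * (2 / tau%:R) :> R.
    rewrite -big_mkcondr (eq_bigl (mem (S :&: X))); last by move=> i; rewrite /= inE.
    by rewrite sumr_const; apply/esym/mulr_natl.
  have [_ /(_ (fun i => if i \in X then 2 / tau%:R else 0))] := hkf.
  have -> : \sum_i (if i \in X then 2 / tau%:R else 0) = 2 :> R.
    rewrite (eq_bigl (mem [set: T])); last by move=> i; rewrite /= inE.
    by rewrite sumX setTI cardX mulrC divfK // gt_eqF.
  have c0 : 0 <= 2 / tau%:R :> R by rewrite divr_ge0 // ltW.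
  apply; split=> [i|S]; first by case: ifP.
  rewrite sumX /v; case: andP => [[_ lt]|_]; last exact: mulr_ge0.
  by rewrite mulrA ler_pdivlMr // mul1r -natrM ler_nat; lia.
rewrite ler_pdivlMr //.
(* The bounds on [k] and on [kf] lose a factor 2 each, which makes the 4. *)
have : tau%:R <= 2 * k%:R :> R by rewrite -natrM ler_nat mul2n.
by nra.
Qed.
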